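(* Let $0\le n\le N-1$, let $C\in\mathbb R_+$, and let the discrete velocity $u^{n+1}=(u_1^{n+1},u_2^{n+1})$ (vanishing on boundary edges) and the discrete water height $h^{n+1}$ be a solution of one step of the scheme, i.e. $$\frac{1}{\delta t}(h_K^{n+1}-h_K^n)+\frac1{|K|}\sum_{\sigma\in\mathcal E(K)}F^n_{K,\sigma}=0\quad\forall K\in\mathcal M,\qquad p_K^{n+1}=\tfrac12 g\,(h_K^{n+1})^2\quad\forall K\in\mathcal M,$$ $$\frac1{\delta t}\bigl(h^{n+1}_{D_\sigma}u^{n+1}_{i,\sigma}-h^n_{D_\sigma}u^n_{i,\sigma}\bigr)+\frac1{|D_\sigma|}\sum_{\epsilon}F^n_{\sigma,\epsilon}u^n_{i,\epsilon}+(\eth_i p^{n+1})_\sigma+g\,h^{n+1}_{\sigma,c}(\eth_i z)_\sigma=0\quad\forall\sigma\in\mathcal E^{(i)}_{\rm int},\ i=1,2,$$ with $u^n=0$ and $h^n_K+z_K=C$ for all $K\in\mathcal M$. Then $u^{n+1}=0$ and $h_K^{n+1}+z_K=C$ for all $K\in\mathcal M$.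
   Context: $\Omega\subset\mathbb R^2$ is a bounded connected open set which is a union of rectangles with edges orthogonal to the canonical basis vectors $e^{(1)},e^{(2)}$. $\mathcal M$ is a conforming structured (possibly non uniform) partition of $\Omega$ into rectangles $K$ (mass center $x_K$) with axis-parallel edges; $\mathcal E(K)$ is the set of edges of $K$; $\mathcal E^{(i)}$ is the set of all edges orthogonal to $e^{(i)}$ and $\mathcal E^{(i)}_{\rm int}$ the subset of internal ones, i.e. those of the form $\sigma=K|L=\partial K\cap\partial L$. For $\sigma=K|L$ the dual cell is $D_\sigma=D_{K,\sigma}\cup D_{L,\sigma}$, where $D_{K,\sigma}$ is the half of $K$ adjacent to $\sigma$; for a boundary edge of $K$, $D_\sigma=D_{K,\sigma}$. $|\cdot|$ is the one- or two-dimensional measure; $g$ is the gravity constant; $\delta t=T/N>0$ is the time step ($N\ge1$ an integer, $T>0$ the final time). Scalar unknowns are one value per cell (water height $h_K$, pressure $p_K$), and the topography is represented by one (time-independent) value $z_K$ per cell. The $i$-th velocity component is given by one value $u_{i,\sigma}$ per $\sigma\in\mathcal E^{(i)}$, vanishing on boundary edges. Primal mass flux: $F_{K,\sigma}=|\sigma|h_\sigma u_{K,\sigma}$, $u_{K,\sigma}=u_{i,\sigma}\,n_{K,\sigma}\cdot e^{(i)}$ for $\sigma\in\mathcal E^{(i)}$ ($n_{K,\sigma}$ unit normal outward $K$), with $h_\sigma=h_K$ if $u_{K,\sigma}\ge0$ and $h_\sigma=h_L$ otherwise for $\sigma=K|L$; $F_{K,\sigma}=0$ on boundary edges. Dual heights: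 $|D_\sigma|h_{D_\sigma}=|D_{K,\sigma}|h_K+|D_{L,\sigma}|h_L$ for $\sigma=K|L$. Centered heights: $h_{\sigma,c}=\frac12(h_K+h_L)$ for $\sigma=K|L$. Discrete gradient: for $\sigma=K|L\in\mathcal E^{(i)}_{\rm int}$ with $(x_L-x_K)\cdot e^{(i)}>0$, $(\eth_i q)_\sigma=\frac{|\sigma|}{|D_\sigma|}(q_L-q_K)$. Dual mass fluxes: the sum over $\epsilon$ runs over the edges $\epsilon$ of the rectangle $D_\sigma$. If $\epsilon$ is orthogonal to $e^{(i)}$ and contained in the cell $K$, with $\sigma,\sigma'$ the two edges of $K$ in $\mathcal E^{(i)}$, then $F_{\sigma,\epsilon}=\frac12(F_{K,\sigma'}-F_{K,\sigma})$. If $\epsilon$ is parallel to $e^{(i)}$, it is the union of halves of an edge $\tau$ of $K$ and an edge $\tau'$ of $L$ ($\sigma=K|L$) and $F_{\sigma,\epsilon}=\frac12(F_{K,\tau}+F_{L,\tau'})$ (which vanishes if $\epsilon$ lies on the boundary). The value $u_{i,\epsilon}$ is the upwind one: $u_{i,\sigma}$ if $F_{\sigma,\epsilon}\ge0$, and otherwise $u_{i,\sigma'}$, where $D_{\sigma'}$ is the dual cell on the other side of $\epsilon$. Superscripts $n$, $n+1$ denote time levels.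
   Formalization: It is additionally assumed that the dual water height at time n+1 is nonzero at every internal edge; if it vanishes (e.g. all heights zero and z=C), the momentum equation leaves the velocity on that edge arbitrary and the claim fails. *)

(* Defs.v *)
From HB Require Import structures.
From mathcomp Require Import all_boot all_order all_algebra.
From mathcomp Require Import all_classical all_reals all_analysis.
Set Implicit Arguments.
Unset Strict Implicit.
Unset Printing Implicit Defensive.
Import Order.TTheory GRing.Theory Num.Theory numFieldNormedType.Exports.
Local Open Scope classical_set_scope.
Local Open Scope ring_scope.

(* An axis-parallel box of R^2, given by its lower and upper corners.  Cells
   are nondegenerate boxes; an edge orthogonal to e^(i) is a box whose two
   corners share their i-th coordinate.  Nonempty closed boxes are equal as
   sets iff they are equal as pairs, so two cells share an edge iff the same
   pair occurs among the edges of both. *)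
Notation box R := ('rV[R]_2 * 'rV[R]_2)%type.

Section Boxes.
Context {R : realType}.
Implicit Types (B K L s : box R) (i j : 'I_2).

Definition closed_box B : set 'rV[R]_2 :=
  [set x | forall i, B.1 0 i <= x 0 i <= B.2 0 i].

Definition open_box B : set 'rV[R]_2 :=
  [set x | forall i, B.1 0 i < x 0 i < B.2 0 i].

Definition nondegenerate B : Prop := forall i, B.1 0 i < B.2 0 i.

Definition side B i : R := B.2 0 i - B.1 0 i.

Definition area B : R := \prod_i side B i.

(* Length of an edge [s] orthogonal to e^(i). *)
Definition elen i s : R := \prod_(j | j != i) side s j.

Definition center B : 'rV[R]_2 := 2^-1 *: (B.1 + B.2).

Definition set_coord (x : 'rV[R]_2) i (c : R) : 'rV[R]_2 :=
  \row_j (if j == i then c else x 0 j).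

(* The edge of [K] orthogonal to e^(i), on the upper side if [b], and on the
   lower side otherwise. *)
Definition face K i (b : bool) : box R :=
  let c := if b then K.2 0 i else K.1 0 i in
  (set_coord K.1 i c, set_coord K.2 i c).

Definition cell_edges K i : seq (box R) := [:: face K i false; face K i true].

Definition vertices K : set 'rV[R]_2 :=
  [set v | forall i, v 0 i = K.1 0 i \/ v 0 i = K.2 0 i].

(* D_{K,s}: the half of [K] adjacent to its edge [s] orthogonal to e^(i). *)
Definition half_cell K i s : box R :=
  let m := center K 0 i in
  if s == face K i true then (set_coord K.1 i m, K.2)
  else (K.1, set_coord K.2 i m).

Definition opp_edge K i s : box R :=
  if s == face K i true then face K i false else face K i true.

(* n_{K,s} . e^(i) for the unit normal outward [K] on its edge [s]
   orthogonal to e^(i). *)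
Definition normal K i s : R := if s == face K i true then 1 else -1.

End Boxes.

Section Mesh.
Context {R : realType}.
Implicit Types (O : set 'rV[R]_2) (M : seq (box R)) (K L s : box R) (i : 'I_2).

Definition is_domain O : Prop :=
  [/\ open O, connected O, bounded_set O &
      exists2 r : seq (box R), (forall B, B \in r -> nondegenerate B) &
        O = \bigcup_(B in [set` r]) open_box B].

Definition conforming_pair K L : Prop :=
  let I := closed_box K `&` closed_box L in
  [\/ I = set0,
      (exists v, [/\ vertices K v, vertices L v & I = [set v]]) |
      (exists i s, [/\ s \in cell_edges K i, s \in cell_edges L i
                     & I = closed_box s])].

(* Conformity rules out hanging nodes, so around each vertex interior to the
   domain the cells are arranged as in a Cartesian grid; cells cut out of a
   global, possibly non uniform, Cartesian grid are a particular case. *)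
Definition is_mesh O M : Prop :=
  [/\ uniq M,
      (forall K, K \in M -> nondegenerate K /\ open_box K `<=` O),
      closure O = \bigcup_(K in [set` M]) closed_box K,
      (forall K L, K \in M -> L \in M -> K != L ->
         open_box K `&` open_box L = set0) &
      (forall K L, K \in M -> L \in M -> K != L -> conforming_pair K L)].

(* E^(i) *)
Definition edges M i : seq (box R) := flatten [seq cell_edges K i | K <- M].

(* s = K|L is orthogonal to e^(i), and (x_L - x_K) . e^(i) > 0. *)
Definition interface M i s K L : Prop :=
  [/\ K \in M, L \in M, s \in cell_edges K i, s \in cell_edges L i
    & 0 < (center L - center K) 0 i].

Definition internal_edge M i s : Prop := exists K L, interface M i s K L.

(* The cell on the other side of the edge [s] of [K], if any; in a mesh it is
   unique. *)
Definition neighbour M K i s : option (box R) :=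
  ohead [seq L <- M | (L != K) && (s \in cell_edges L i)].

End Mesh.

(* Discrete fields are functions on boxes; only the values of scalar fields on
   the cells, and of the i-th velocity component on the edges in E^(i), are
   ever constrained or used. *)
Section Scheme.
Context {R : realType}.
Variable M : seq (box R).
Implicit Types (q h : box R -> R) (u : 'I_2 -> box R -> R).
Implicit Types (K L s : box R) (i : 'I_2).

Definition vel u K i s : R := u i s * normal K i s.

(* F_{K,s} *)
Definition flux h u K i s : R :=
  if neighbour M K i s is Some L then
    elen i s * (if 0 <= vel u K i s then h K else h L) * vel u K i s
  else 0.

Definition flux_sum h u K : R :=
  \sum_(i < 2) \sum_(s <- cell_edges K i) flux h u K i s.

Definition dual_area i s K L : R :=
  area (half_cell K i s) + area (half_cell L i s).

Definition dual_height h i s K L : R :=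
  (area (half_cell K i s) * h K + area (half_cell L i s) * h L)
  / dual_area i s K L.

Definition centered_height h K L : R := 2^-1 * (h K + h L).

Definition grad q i s K L : R := elen i s / dual_area i s K L * (q L - q K).

(* F u_eps with u_eps upwinded: [a] is the value in the dual cell and [b] the
   value in the dual cell on the other side of eps. *)
Definition upwind (F a b : R) : R := F * (if 0 <= F then a else b).

(* Contribution to the dual balance on D_s of the edge eps orthogonal to
   e^(i) contained in the cell [X]. *)
Definition conv_normal h u i s X : R :=
  let s' := opp_edge X i s in
  upwind (2^-1 * (flux h u X i s' - flux h u X i s)) (u i s) (u i s').

(* The value u_{i,s'} for the dual cell on the other side of the edge of D_s
   made of halves of the edges [t] of K and [t'] of L orthogonal to e^(j),
   j <> i, where s = K|L with K below L in the direction e^(i).  The edge s'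
   prolongs s, hence is the upper edge of the cell across [t] and the lower
   edge of the cell across [t'], whichever exists; if both exist they agree by
   conformity, and if neither does then eps lies on the boundary and its flux
   vanishes, so that the value 0 is not used. *)
Definition across_value u i K L j t t' : R :=
  if neighbour M K j t is Some K' then u i (face K' i true)
  else if neighbour M L j t' is Some L' then u i (face L' i false)
  else 0.

Definition conv_tangent h u i s K L j b : R :=
  let t := face K j b in
  let t' := face L j b in
  upwind (2^-1 * (flux h u K j t + flux h u L j t'))
    (u i s) (across_value u i K L j t t').

(* Sum over the four edges eps of D_s, s = K|L. *)
Definition dual_flux_sum h u i s K L : R :=
  conv_normal h u i s K + conv_normal h u i s L
  + \sum_(j < 2 | j != i) \sum_(b : bool) conv_tangent h u i s K L j b.

Definition mass_step (dt : R) h u h1 : Prop :=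
  forall K, K \in M ->
    dt^-1 * (h1 K - h K) + (area K)^-1 * flux_sum h u K = 0.

Definition pressure_law (g : R) h1 p1 : Prop :=
  forall K, K \in M -> p1 K = 2^-1 * g * h1 K ^+ 2.

Definition momentum_step (dt g : R) (z : box R -> R) h u h1 u1 p1 : Prop :=
  forall i s K L, interface M i s K L ->
    dt^-1 * (dual_height h1 i s K L * u1 i s - dual_height h i s K L * u i s)
    + (dual_area i s K L)^-1 * dual_flux_sum h u i s K L
    + grad p1 i s K L
    + g * centered_height h1 K L * grad z i s K L = 0.

Definition vanishes_on_boundary u : Prop :=
  forall i s, s \in edges M i -> ~ internal_edge M i s -> u i s = 0.

Definition velocity_zero u : Prop := forall i s, s \in edges M i -> u i s = 0.

End Scheme.

(* Main.v *)
Require Import Defs.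
From mathcomp Require Import all_boot all_order all_algebra.
From mathcomp Require Import all_classical all_reals all_analysis.
From mathcomp Require Import ring.
Import Order.TTheory GRing.Theory Num.Theory.
Local Open Scope ring_scope.

(** At rest all mass fluxes vanish, so the mass balance gives
    [h^{n+1} = h^n].  The momentum balance then reduces to
    [h_D u^{n+1} / dt + grad p + g h_c grad z = 0], and the factorization
    [(h_L^2 - h_K^2) / 2 = h_c (h_L - h_K)] turns the last two terms into
    [g h_c grad (h + z)], which is zero. *)

Lemma face_in_edges (R : realType) (M : seq (box R)) (K : box R) (i : 'I_2) b :
  K \in M -> face K i b \in edges M i.
Proof.
move=> KM; apply/flattenP; exists (cell_edges K i); first exact: map_f.
by rewrite !inE; case: b; rewrite eqxx ?orbT.
Qed.

(** Whichever height the upwinding selects, it is multiplied by a zero normal velocity; without a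
    neighbour the flux is zero by convention. *)
Lemma flux_at_rest (R : realType) (M : seq (box R)) (h : box R -> R)
    (u : 'I_2 -> box R -> R) (K : box R) (i : 'I_2) (b : bool) :
  velocity_zero M u -> K \in M -> flux M h u K i (face K i b) = 0.
Proof.
move=> u0 KM; rewrite /flux /vel u0 ?face_in_edges// mul0r.
by case: neighbour => // L; rewrite mulr0.
Qed.

Lemma cell_edgesP (R : realType) (K s : box R) (i : 'I_2) :
  s \in cell_edges K i -> exists b, s = face K i b.
Proof. by rewrite !inE => /orP[]/eqP->; [exists false | exists true]. Qed.

Lemma opp_edge_face (R : realType) (K s : box R) (i : 'I_2) :
  exists b, opp_edge K i s = face K i b.
Proof. by rewrite /opp_edge; case: ifP => _; [exists false | exists true]. Qed.

Lemma flux_sum_at_rest (R : realType) (M : seq (box R)) (h : box R -> R)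
    (u : 'I_2 -> box R -> R) (K : box R) :
  velocity_zero M u -> K \in M -> flux_sum M h u K = 0.
Proof.
move=> u0 KM; apply: big1 => i _.
by rewrite big_cons big_seq1 !flux_at_rest// addr0.
Qed.

(** The edge opposite to [s] is again an edge of [K], so both primal fluxes in the half-difference
    vanish. *)
Lemma conv_normal_at_rest (R : realType) (M : seq (box R)) (h : box R -> R)
    (u : 'I_2 -> box R -> R) (i : 'I_2) (s K : box R) :
  velocity_zero M u -> K \in M -> s \in cell_edges K i ->
  conv_normal M h u i s K = 0.
Proof.
move=> u0 KM /cell_edgesP[b ->]; rewrite /conv_normal /upwind.
have [b' ->] := opp_edge_face R K (face K i b) i.
by rewrite !flux_at_rest// subrr mulr0 mul0r.
Qed.

Lemma dual_flux_sum_at_rest (R : realType) (M : seq (box R)) (h : box R -> R)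
    (u : 'I_2 -> box R -> R) (i : 'I_2) (s K L : box R) :
  velocity_zero M u -> interface M i s K L -> dual_flux_sum M h u i s K L = 0.
Proof.
move=> u0 [KM LM sK sL _].
rewrite /dual_flux_sum !conv_normal_at_rest// !add0r.
apply: big1 => j _; apply: big1 => b _.
(* The flux factor is already zero, so the transported value [across_value] need not be
   identified. *)
by rewrite /conv_tangent /upwind !flux_at_rest// addr0 mulr0 mul0r.
Qed.

Lemma hydrostatic_balance (R : realType) (M : seq (box R)) (g C : R)
    (h p z : box R -> R) (i : 'I_2) (s K L : box R) :
  pressure_law M g h p -> K \in M -> L \in M ->
  h K + z K = C -> h L + z L = C ->
  grad p i s K L + g * centered_height h K L * grad z i s K L = 0.
Proof.
move=> hp KM LM hK hL; rewrite /grad /centered_height !hp//.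
(* Once [z] is eliminated, the identity is polynomial in [h K] and [h L], with the ratio of [elen]
   to [dual_area] as a common symbolic factor: no division has to be justified. *)
have -> : z K = C - h K by rewrite -hK addrC addKr.
have -> : z L = C - h L by rewrite -hL addrC addKr.
by ring.
Qed.

Theorem lemma2 (R : realType) (Omega : set 'rV[R]_2) (M : seq (box R))
    (g T : R) (N n : nat) (z : box R -> R) (C : R)
    (h p : nat -> box R -> R) (u : nat -> 'I_2 -> box R -> R)
    (hOmega : is_domain Omega) (hM : is_mesh Omega M)
    (hg : 0 < g) (hT : 0 < T) (hN : (1 <= N)%N) (hn : (n <= N - 1)%N)
    (hC : 0 <= C)
    (hbd : vanishes_on_boundary M (u n.+1))
    (hmass : mass_step M (T / N%:R) (h n) (u n) (h n.+1))
    (hp : pressure_law M g (h n.+1) (p n.+1))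
    (hmom : momentum_step M (T / N%:R) g z (h n) (u n)
              (h n.+1) (u n.+1) (p n.+1))
    (* no dry dual cell: the momentum balance does determine [u n.+1] *)
    (hwet : forall i s K L, interface M i s K L ->
              dual_height (h n.+1) i s K L != 0)
    (hu0 : velocity_zero M (u n))
    (hlake : forall K, K \in M -> h n K + z K = C) :
  velocity_zero M (u n.+1) /\ (forall K, K \in M -> h n.+1 K + z K = C).
Proof.
have dtV0 : (T / N%:R)^-1 != 0.
  by rewrite invr_neq0// mulf_neq0 ?gt_eqF// invr_gt0 ltr0n.
have lake K : K \in M -> h n.+1 K + z K = C.
  move=> KM; rewrite -(hlake K KM); congr (_ + _).
  have /eqP := hmass K KM.
  by rewrite flux_sum_at_rest// mulr0 addr0 mulf_eq0 (negbTE dtV0) subr_eq0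
    => /eqP.
split=> // i s sM.
(* The momentum balance is available on internal edges only; the boundary condition settles the
   others. *)
have [[K [L sKL]]|/hbd] := pselect (internal_edge M i s); last exact.
have [KM LM _ _ _] := sKL.
have /eqP := hmom i s K L sKL.
rewrite (hu0 i s sM) dual_flux_sum_at_rest// !mulr0 subr0 addr0 -addrA.
rewrite (hydrostatic_balance R M g C)//; [|exact: lake|exact: lake].
(* What remains is that the product of [dt^-1], the new dual height and the new velocity is zero.
   The lake equation alone would not suffice here: where [z K = z L = C] the dual height is zero and
   the velocity is left free, hence the appeal to [hwet]. *)
rewrite addr0 mulf_eq0 (negbTE dtV0) /=.
by rewrite mulf_eq0 (negbTE (hwet _ _ _ _ sKL)) => /eqP.
Qed.
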